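(* There exist $b_1,b_2\in L^\infty_{loc}(\mathbb{R})$ such that $C_bH=[b_2,[b_1,H]]$ is bounded on $L^2(\mathbb{R})$, but $S_{A,B}(b_1,b_2)=\infty$ and $T_C(b_1,b_2)=\infty$ for all log-bumps $A,B,C$ with $\bar A,\bar B,\bar C\in B_2$.
   Context: $H$ is the Hilbert transform $Hf(x)=\lim_{\varepsilon\to0}\int_{|x-y|>\varepsilon}\frac{f(y)}{x-y}dy$; $[A,B]=AB-BA$ with $b_i$ acting by multiplication; the commutator is defined on $L^\infty_c$ and bounded on $L^2$ means $\|C_bHf\|_2\le K\|f\|_2$ for $f\in L^\infty_c$. A log-bump is a function $\Phi(t)=t^p\log(e+t)^{p-1+\delta}$ on $[0,\infty)$ with $p\in(1,\infty)$, $\delta\in(0,\infty)$ (a Young function). For a Young function $A$: $\bar A(t)=\sup_{s>0}\{st-A(s)\}$; $A\in B_2$ means $\int_1^\infty\frac{A(t)}{t^2}\frac{dt}{t}<\infty$; $\langle|f|\rangle_{A,I}=\inf\{\lambda>0:\frac1{|I|}\int_IA(|f|/\lambda)\le1\}$. With $\langle g\rangle_I=\frac1{|I|}\int_Ig$ and suprema over intervals $I$: $S_{A,B}(b_1,b_2)=\sup_I\langle|b_1-\langle b_1\rangle_I|\rangle_{A,I}\langle|b_2-\langle b_2\rangle_I|\rangle_{B,I}$, $T_C(b_1,b_2)=\sup_I\langle|b_1-\langle b_1\rangle_I||b_2-\langle b_2\rangle_I|\rangle_{C,I}$. *)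

(* Defs.v *)
From HB Require Import structures.
From mathcomp Require Import all_boot all_order all_algebra.
From mathcomp Require Import all_classical all_reals all_analysis.
Set Implicit Arguments. Unset Strict Implicit. Unset Printing Implicit Defensive.
Import Order.TTheory GRing.Theory Num.Theory.
Import numFieldNormedType.Exports.
Local Open Scope classical_set_scope.
Local Open Scope ring_scope.

Section Defs.
Variable R : realType.
Local Notation mu := (@lebesgue_measure R).

Definition Linf_loc (b : R -> R) : Prop :=
  measurable_fun setT b /\
  forall a c : R, exists M : R,
    {ae mu, forall x, x \in `[a, c] -> `|b x| <= M}.

Definition Linf_c (f : R -> R) : Prop :=
  [/\ measurable_fun setT f,
      exists M : R, {ae mu, forall x, `|f x| <= M}
    & exists a c : R, forall x, x \notin `[a, c] -> f x = 0].

Definition hilbert_trunc (f : R -> R) (eps x : R) : R :=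
  Rintegral mu [set y | eps < `|x - y|] (fun y => f y / (x - y)).

Definition hilbert (f : R -> R) (x : R) : R :=
  lim (hilbert_trunc f eps x @[eps --> 0^'+]).

Definition commutator (b : R -> R) (T : (R -> R) -> (R -> R))
  : (R -> R) -> (R -> R) :=
  fun f x => b x * T f x - T (fun y => b y * f y) x.

Definition CbH (b1 b2 : R -> R) : (R -> R) -> (R -> R) :=
  commutator b2 (commutator b1 hilbert).

Definition L2norm (f : R -> R) : \bar R := Lnorm mu 2%:E (EFin \o f).

Definition L2_bounded (T : (R -> R) -> (R -> R)) : Prop :=
  exists K : R, forall f, Linf_c f ->
    (L2norm (T f) <= K%:E * L2norm f)%E.

Definition log_bump (p delta : R) (t : R) : R :=
  t `^ p * (ln (expR 1 + t)) `^ (p - 1 + delta).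

Definition is_log_bump (A : R -> R) : Prop :=
  exists p delta : R, 1 < p /\ 0 < delta /\ A = log_bump p delta.

Definition young_conj (A : R -> R) (t : R) : \bar R :=
  ereal_sup [set ((s * t - A s)%:E) | s in [set s : R | 0 < s]].

(* B_2 condition:  ∫_1^∞ A(t)/t^2 dt/t < ∞ *)
Definition B2 (A : R -> \bar R) : Prop :=
  (\int[mu]_(t in `[1%R, +oo[%classic) (A t * ((t ^+ 3)^-1)%:E) < +oo)%E.

Definition avg (a c : R) (g : R -> R) : R :=
  (c - a)^-1 * Rintegral mu `[a, c] g.

Definition lux_norm (A : R -> R) (a c : R) (f : R -> R) : \bar R :=
  ereal_inf [set (lam%:E) | lam in [set lam : R | 0 < lam /\
     (((c - a)^-1)%:E * \int[mu]_(y in `[a, c]) (A (`|f y| / lam))%:E <= 1)%E]].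

Definition osc (b : R -> R) (a c : R) : R -> R :=
  fun y => `|b y - avg a c b|.

Definition S_AB (A B : R -> R) (b1 b2 : R -> R) : \bar R :=
  ereal_sup [set (lux_norm A I.1 I.2 (osc b1 I.1 I.2) *
                  lux_norm B I.1 I.2 (osc b2 I.1 I.2))%E
            | I in [set I : R * R | I.1 < I.2]].

Definition T_C (C : R -> R) (b1 b2 : R -> R) : \bar R :=
  ereal_sup [set lux_norm C I.1 I.2
                   (fun y => osc b1 I.1 I.2 y * osc b2 I.1 I.2 y)
            | I in [set I : R * R | I.1 < I.2]].
End Defs.

(* Main.v *)
Require Import Defs.
From HB Require Import structures.
From mathcomp Require Import all_boot all_order all_algebra.
From mathcomp Require Import all_classical all_reals all_analysis.
From mathcomp Require Import measurable_realfun lra ring.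
Set Implicit Arguments. Unset Strict Implicit. Unset Printing Implicit Defensive.
Import Order.TTheory GRing.Theory Num.Theory.
Import numFieldNormedType.Exports.
Local Open Scope classical_set_scope.
Local Open Scope ring_scope.

(** Take [b2] the indicator of the negative half-line and [b1 >= 0] in L2,
    supported in [[1, oo)].  Then [C_b H f] is [- b1 H(b2 f)] on [[0, oo)] and
    [- H(b1 f)] on the negative half-line; since the two supports are at distance
    [1], no principal value is involved, and Cauchy-Schwarz bounds [C_b H f]
    pointwise by a fixed L2 function times the L2 norm of [f].

    On [[-L, L]] the oscillation of [b2] is constantly [1/2], so both [S] and [T]
    reduce to the Luxemburg norm of the oscillation of [b1].  The [B_2] condition
    forces [p >= 2], hence a log-bump dominates [t^2 log t].  Placing in [b1], near
    each integer [n], a very high spike of squared L2 norm [2^-(n+1)] makes the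
    logarithm beat both [2^-(n+1)] and the length of the interval. *)

(** The integral of a nonnegative function is the supremum over the nonnegative simple functions
    below it, hence monotone even for functions such as [CbH b1 b2 f] or [young_conj A], whose
    measurability is not established here. *)
Lemma ge0_le_integral_nomeas (d : measure_display) (T : measurableType d)
    (R : realType) (mu : {measure set T -> \bar R}) (D : set T)
    (f g : T -> \bar R) :
  (forall x, D x -> (0 <= f x)%E) -> (forall x, D x -> (f x <= g x)%E) ->
  (\int[mu]_(x in D) f x <= \int[mu]_(x in D) g x)%E.
Proof.
move=> f0 fg.
rewrite !ge0_integralE//; last by move=> x Dx; exact: le_trans (f0 _ Dx) (fg _ Dx).
apply: le_ereal_sup => _ [h /= hf <-].
by exists h => //= x; apply: (le_trans (hf x)); exact: lee_restrict.
Qed.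

Lemma measurable_inv (R : realType) : measurable_fun setT (@GRing.inv R).
Proof.
(* [x ^+ 2] is nonnegative, so its real power of exponent -1 is its inverse; at 0 both sides are
   0. *)
rewrite (_ : @GRing.inv R = fun x => x * (x ^+ 2) `^ (-1)).
  apply: measurable_funM => //.
  exact: (measurableT_comp (measurable_powR (-1)) (@exprn_measurable R setT 2)).
apply/funext => x; rewrite powR_inv1 ?sqr_ge0// expr2 invfM.
by have [->|x0] := eqVneq x 0; rewrite ?invr0 ?mul0r// mulrA divff ?mul1r.
Qed.

(** * L2 estimates, and the Hilbert transform away from its singularity *)

Section L2.
Variable R : realType.
Local Notation mu := (@lebesgue_measure R).
Implicit Types f g : R -> R.

Lemma L2normE f : L2norm f = ((\int[mu]_x (f x ^+ 2)%:E) `^ 2^-1)%E.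
Proof.
rewrite /L2norm unlock; congr (_ `^ _)%E.
by apply: eq_integral => x _ /=; rewrite powR_mulrn// real_normK ?num_real.
Qed.

Lemma L2norm_ge0 f : (0 <= L2norm f)%E.
Proof. exact: Lnorm_ge0. Qed.

Lemma L2norm_fin f : (\int[mu]_x (f x ^+ 2)%:E < +oo)%E -> (L2norm f < +oo)%E.
Proof. by rewrite L2normE => h; exact: poweR_lty. Qed.

Lemma L2norm_le_scale (F : R) f g : 0 <= F -> measurable_fun setT g ->
  (forall x, `|f x| <= F * g x) -> (L2norm f <= F%:E * L2norm g)%E.
Proof.
move=> F0 mg fg; rewrite !L2normE.
have I0 h : (0 <= \int[mu]_x (h x ^+ 2)%:E)%E.
  by apply: integral_ge0 => x _; rewrite lee_fin sqr_ge0.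
have -> : F%:E = ((F ^+ 2)%:E `^ 2^-1)%E.
  by rewrite /= powR12_sqrt ?sqr_ge0// sqrtr_sqr ger0_norm.
rewrite -poweRM// ?lee_fin ?sqr_ge0//.
apply: gt0_ler_poweR; rewrite ?in_itv/= ?leey ?andbT ?I0 ?mule_ge0 ?lee_fin ?sqr_ge0//.
rewrite -ge0_integralZl_EFin//; last 3 first.
- by move=> x _; rewrite lee_fin sqr_ge0.
- by apply/measurable_EFinP; exact: measurable_funX.
- by rewrite sqr_ge0.
apply: ge0_le_integral_nomeas => x _; first by rewrite lee_fin sqr_ge0.
rewrite -EFinM lee_fin -exprMn -(real_normK (num_real (f x))).
by rewrite ler_pXn2r ?nnegrE//; exact: le_trans (fg x).
Qed.

Lemma cauchy_schwarz_L2 f g : measurable_fun setT f -> measurable_fun setT g ->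
  (\int[mu]_x (`|f x| * `|g x|)%:E <= L2norm f * L2norm g)%E.
Proof.
move=> mf mg.
have h : (2^-1 + 2^-1 = 1 :> R) by lra.
have := @hoelder _ _ R mu f g 2 2 mf mg (ltr0Sn _ 1) (ltr0Sn _ 1) h.
rewrite Lnorm1; apply: le_trans.
by rewrite le_eqVlt; apply/orP; left; apply/eqP/eq_integral => x _ /=; rewrite normrM.
Qed.

(* If the truncated integrals diverge, [lim] is the default point [0]. *)
Lemma norm_hilbert_le f x (M : R) : measurable_fun setT f ->
  (\int[mu]_y (`|f y| / `|x - y|)%:E <= M%:E)%E -> `|hilbert f x| <= M.
Proof.
move=> mf fM.
have mk : measurable_fun setT (fun y => f y / (x - y)).
  apply: measurable_funM => //.
  apply: (measurableT_comp (@measurable_inv R)).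
  exact: measurable_funB.
have M0 : 0 <= M.
  rewrite -lee_fin; apply: le_trans fM; apply: integral_ge0 => y _.
  by rewrite lee_fin divr_ge0.
have tM eps : `|hilbert_trunc f eps x| <= M.
  rewrite -lee_fin; apply: le_trans fM.
  have mD : measurable [set y : R | eps < `|x - y|].
    rewrite (_ : [set _ | _] = (fun y => `|x - y|) @^-1` `]eps, +oo[%classic).
      rewrite -[_ @^-1` _]setTI.
      by apply: (measurableT_comp (@normr_measurable _ setT) (measurable_funB _ _)).
    by apply/seteqP; split=> y /=; rewrite in_itv/= andbT.
  rewrite /hilbert_trunc /Rintegral.
  set I := (X in fine X).
  have : (`|I| <= \int[mu]_(y in [set y | (eps < `|x - y|)%R]) `|(f y / (x - y))%:E|)%E.
    apply: le_abse_integral => //; apply/measurable_EFinP.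
    exact: measurable_funTS.
  rewrite -abse_EFin => h; apply: (@le_trans _ _ `|I|%E).
    (* [fine] sends infinite values to 0, so the bound also covers an infinite truncated
       integral. *)
    by case: I {h} => [r| |] //=; rewrite ?normr0 ?leey.
  apply: (le_trans h); rewrite integral_mkcond.
  apply: ge0_le_integral_nomeas => y _ /=; rewrite patchE; case: ifP => // _.
    by rewrite lee_fin normrM normfV.
  by rewrite lee_fin divr_ge0.
rewrite /hilbert; have [c|/dvgP ->] := pselect (cvg (hilbert_trunc f eps x @[eps --> 0^'+])).
  rewrite ler_norml; apply/andP; split.
    by apply: limr_ge => //; apply: nearW => e; have := tM e; rewrite ler_norml => /andP[].
  by apply: limr_le => //; apply: nearW => e; have := tM e; rewrite ler_norml => /andP[].
by rewrite /point/= normr0.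
Qed.

(** Majorant of the Hilbert kernel: if one of two points is at least 1 and the other is negative,
    the inverse of their distance is at most [decay] of the negative one. *)
Definition decay (x : R) : R := (1 + `|x|)^-1.

Lemma decay_gt0 x : 0 < decay x.
Proof. by rewrite invr_gt0 ltr_wpDr. Qed.

Lemma measurable_decay : measurable_fun setT decay.
Proof.
apply: (measurableT_comp (@measurable_inv R)).
by apply: measurable_funD.
Qed.

(** Comparison with 1/(1+x^2), since (1+|x|)^2 >= 1+x^2. *)
Lemma L2norm_decay_fin : (L2norm decay < +oo)%E.
Proof.
apply: L2norm_fin; apply: (@le_lt_trans _ _ (\int[mu]_x ((oneDsqr x)^-1)%:E)%E).
  apply: ge0_le_integral_nomeas => x _; rewrite lee_fin ?sqr_ge0//.
  rewrite /decay exprVn lef_pV2 ?posrE ?exprn_gt0 ?(lt_le_trans ltr01 (oneDsqr_ge1 _)) ?ltr_wpDr//.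
  rewrite /oneDsqr -(real_normK (num_real x)); have := normr_ge0 x; nra.
rewrite (@ge0_symfun_integralT _ (fun x => (oneDsqr x)^-1)).
- rewrite (_ : [set x | 0 <= x] = `[0, +oo[%classic); last first.
    by apply/seteqP; split=> x /=; rewrite in_itv/= andbT.
  by rewrite integral0y_oneDsqr -EFinM ltry.
- by move=> x; rewrite invr_ge0 ltW// (lt_le_trans ltr01 (oneDsqr_ge1 _)).
- exact: continuous_oneDsqrV.
- by move=> x /=; rewrite /oneDsqr sqrrN.
Qed.

End L2.

(** * L2 boundedness of the iterated commutator *)

Section half_line_commutator.
Variable R : realType.
Local Notation mu := (@lebesgue_measure R).
Implicit Types f b : R -> R.

Definition half_line : R -> R := \1_(`]-oo, 0[%classic).

Lemma half_lineE x : half_line x = (x < 0)%R%:R.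
Proof. by rewrite /half_line indicE mem_setE in_itv. Qed.

Lemma measurable_half_line : measurable_fun setT half_line.
Proof. exact: measurable_indic. Qed.

(** Here the integration variable y is the negative point, so the kernel is at most [decay y] and
    Cauchy-Schwarz pairs it with f, uniformly in x. *)
Lemma hilbert_half_line_le f x : measurable_fun setT f ->
  (L2norm f < +oo)%E -> 1 <= x ->
  `|hilbert (fun y => half_line y * f y) x|
    <= fine (L2norm f) * fine (L2norm (@decay R)).
Proof.
move=> mf ff x1; apply: norm_hilbert_le.
  by apply: measurable_funM => //; exact: measurable_half_line.
rewrite EFinM !fineK ?ge0_fin_numE ?L2norm_ge0 ?L2norm_decay_fin//.
apply: le_trans (cauchy_schwarz_L2 mf (@measurable_decay R)).
apply: ge0_le_integral_nomeas => y _; first by rewrite lee_fin divr_ge0.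
rewrite lee_fin half_lineE; have [y0|y0] := ltP y 0; last first.
  by rewrite mul0r normr0 mul0r mulr_ge0.
rewrite mul1r ler_wpM2l// [leRHS]gtr0_norm ?decay_gt0//.
by rewrite /decay (ltr0_norm y0) gtr0_norm ?lef_pV2 ?posrE; lra.
Qed.

(** Here x is the negative point: [decay x] leaves the integral, and Cauchy-Schwarz is applied to b
    and f. *)
Lemma hilbert_right_le b f x : measurable_fun setT b ->
  (forall y, y < 1 -> b y = 0) -> (L2norm b < +oo)%E ->
  measurable_fun setT f -> (L2norm f < +oo)%E -> x < 0 ->
  `|hilbert (fun y => b y * f y) x|
    <= fine (L2norm f) * (fine (L2norm b) * decay x).
Proof.
move=> mb b0 fb mf ff x0; apply: norm_hilbert_le; first exact: measurable_funM.
rewrite mulrA mulrC !EFinM !fineK ?ge0_fin_numE ?L2norm_ge0//.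
have dx := decay_gt0 x.
apply: (@le_trans _ _ ((decay x)%:E * \int[mu]_y (`|f y| * `|b y|)%:E)%E); last first.
  by apply: lee_wpmul2l; [rewrite lee_fin ltW | exact: cauchy_schwarz_L2].
rewrite -ge0_integralZl_EFin//; last 2 first.
- by apply/measurable_EFinP; apply: measurable_funM; exact: measurableT_comp.
- exact: ltW.
apply: ge0_le_integral_nomeas => y _; first by rewrite lee_fin divr_ge0.
rewrite -EFinM lee_fin; have [/b0->|y1] := ltP y 1.
  by rewrite mul0r normr0 mul0r mulr0 mulr0.
rewrite normrM (mulrC `|b y|) [leRHS]mulrC; apply: ler_wpM2l; first exact: mulr_ge0.
by rewrite /decay (ltr0_norm x0) ltr0_norm ?lef_pV2 ?posrE; lra.
Qed.


Lemma hilbert_cst0 x : hilbert (fun=> 0) x = 0 :> R.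
Proof.
apply/eqP; rewrite -normr_le0; apply: norm_hilbert_le => //.
by under eq_integral do rewrite normr0 mul0r; rewrite integral0.
Qed.

Lemma half_line_commutator_bounded b : measurable_fun setT b ->
  (forall y, 0 <= b y) -> (forall y, y < 1 -> b y = 0) -> (L2norm b < +oo)%E ->
  L2_bounded (CbH b half_line).
Proof.
move=> mb bge0 b0 fb.
set B := fine (L2norm b); set W := fine (L2norm (@decay R)).
have BE : L2norm b = B%:E by rewrite fineK// ge0_fin_numE ?L2norm_ge0.
have WE : L2norm (@decay R) = W%:E.
  by rewrite fineK// ge0_fin_numE ?L2norm_ge0 ?L2norm_decay_fin.
have B0 : 0 <= B by rewrite fine_ge0 ?L2norm_ge0.
have W0 : 0 <= W by rewrite fine_ge0 ?L2norm_ge0.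
have BW0 : 0 <= B * W by rewrite mulr_ge0.
(* Each of the two terms of [G] below has L2 norm at most [B * W]; the added 1 makes the constant
   positive, which settles the case of infinite [L2norm f]. *)
exists (2 * (B * W) + 1) => f [mf _ _].
have [->|] := eqVneq (L2norm f) +oo%E.
  by rewrite gt0_muley ?leey// lte_fin; lra.
rewrite -ltey => ff; set F := fine (L2norm f).
have FE : L2norm f = F%:E by rewrite fineK// ge0_fin_numE ?L2norm_ge0.
have F0 : 0 <= F by rewrite fine_ge0 ?L2norm_ge0.
pose G x := W * b x + B * decay x.
have mG1 : measurable_fun setT (fun x => W * b x) by exact: measurable_funM.
have mG2 : measurable_fun setT (fun x => B * decay x).
  by apply: measurable_funM => //; exact: measurable_decay.
have mG : measurable_fun setT G by exact: measurable_funD.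
have le_G x : `|CbH b half_line f x| <= F * G x.
  have dx := decay_gt0 x.
  rewrite /CbH /commutator.
  (* The supports of [b] and [half_line] are disjoint, so the term in which both multiply f
     vanishes. *)
  rewrite (_ : (fun y => b y * (half_line y * f y)) = fun=> 0); last first.
    apply/funext => y; rewrite half_lineE; have [y0|y0] := ltP y 0.
      by rewrite b0 ?mul0r//; lra.
    by rewrite mul0r mulr0.
  rewrite hilbert_cst0 subr0 half_lineE.
  have [x0|x0] := ltP x 0.
    rewrite /G b0; last lra.
    rewrite !mul0r mulr0 mul1r sub0r subr0 add0r normrN.
    exact: hilbert_right_le.
  rewrite mul0r sub0r normrN.
  have [x1|x1] := ltP x 1.
    by rewrite b0// mul0r normr0 mulr_ge0// addr_ge0 ?mulr_ge0 ?bge0// ltW.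
  rewrite normrM (ger0_norm (bge0 x)).
  have := hilbert_half_line_le mf ff x1; rewrite -/F -/W => h.
  apply: (@le_trans _ _ (b x * (F * W))); first by rewrite ler_wpM2l.
  rewrite /G mulrDr [in leLHS]mulrC -mulrA lerDl !mulr_ge0// ltW//.
apply: (le_trans (L2norm_le_scale F0 mG le_G)).
have : (L2norm G <= (2 * (B * W))%:E)%E.
  apply: (le_trans (eminkowski mu mG1 mG2 (_ : (1 <= 2%:E)%E))).
    by rewrite lee_fin; lra.
  have -> : (2 * (B * W))%:E = (W%:E * L2norm b + B%:E * L2norm (@decay R))%E.
    by rewrite BE WE -!EFinM -EFinD; congr EFin; lra.
  apply: leeD.
    by apply: L2norm_le_scale => // x; rewrite ger0_norm// mulr_ge0.
  apply: L2norm_le_scale => //; first exact: measurable_decay.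
  by move=> x; rewrite ger0_norm// mulr_ge0// ltW// decay_gt0.
rewrite FE => h; apply: (le_trans (lee_wpmul2l (_ : (0 <= F%:E)%E) h)) => //.
by rewrite -!EFinM lee_fin; nra.
Qed.

End half_line_commutator.

(** * Log-bumps: growth, the $B_2$ condition, Luxemburg norms from below *)

Section log_bump_theory.
Variable R : realType.
Local Notation mu := (@lebesgue_measure R).
Implicit Types p delta s t : R.

Lemma ln_eD_ge1 t : 0 <= t -> 1 <= ln (expR 1 + t).
Proof.
move=> t0; rewrite -[leLHS]expRK ler_ln ?posrE ?expR_gt0 ?ltr_wpDr ?expR_gt0//.
by rewrite lerDl.
Qed.

Lemma log_bump_ge0 p delta t : 0 <= log_bump p delta t.
Proof. by rewrite mulr_ge0 ?powR_ge0. Qed.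

Lemma log_bump_nd p delta s t : 1 < p -> 0 < delta -> 0 <= s -> s <= t ->
  log_bump p delta s <= log_bump p delta t.
Proof.
move=> p1 d0 s0 st; have t0 := le_trans s0 st.
have := ln_eD_ge1 s0; have := ln_eD_ge1 t0 => ht hs.
apply: ler_pM; rewrite ?powR_ge0//; apply: ge0_ler_powR; rewrite ?nnegrE//; try lra.
by rewrite ler_ln ?posrE ?ltr_wpDr ?expR_gt0// lerD2l.
Qed.

Lemma log_bump_ge_powR p delta t : 1 < p -> 0 < delta -> 0 <= t ->
  t `^ p <= log_bump p delta t.
Proof.
move=> p1 d0 t0; rewrite ler_peMr ?powR_ge0//.
apply: (@le_trans _ _ (1 `^ (p - 1 + delta))); first by rewrite powR1.
by have := ln_eD_ge1 t0 => h; apply: ge0_ler_powR; rewrite ?nnegrE//; lra.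
Qed.

(** The exponent p-1+delta and the base ln(e+s) are both at least 1, so a full factor ln s
    survives. *)
Lemma log_bump_ge_sqr_ln p delta s : 2 <= p -> 0 < delta -> 1 <= s ->
  s ^+ 2 * ln s <= log_bump p delta s.
Proof.
move=> p2 d0 s1; have s0 : 0 < s by lra.
apply: ler_pM; [exact: sqr_ge0|exact: ln_ge0| |].
  by rewrite -powR_mulrn ?(ltW s0)//; apply: ler_powR.
have h := ln_eD_ge1 (ltW s0).
apply: (@le_trans _ _ (ln (expR 1 + s))).
  by rewrite ler_ln ?posrE// ?ltr_wpDl ?ltr_wpDr ?expR_gt0 ?expR_ge0// lerDr expR_ge0.
rewrite -[leLHS]powRr1; last lra.
by apply: ler_powR => //; lra.
Qed.

(** For p < 2 any power of the logarithm is absorbed by the missing power s^(2-p). *)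
Lemma log_bump_le_sqr p delta : 1 < p -> p < 2 -> 0 < delta ->
  exists2 M, 0 < M & forall s, 1 <= s -> log_bump p delta s <= M * s ^+ 2.
Proof.
move=> p1 p2 d0; set a := p - 1 + delta; have a0 : 0 < a by rewrite /a; lra.
(* Raising ln u <= u^e / e to the power a, with e a = 2-p and u = [expR 1 + s], gives a multiple of
   u^(2-p); then u <= [(expR 1 + 1) * s] because s >= 1. *)
pose e := (2 - p) / a; have e0 : 0 < e by rewrite divr_gt0//; lra.
exists ((e^-1) `^ a * (expR 1 + 1) `^ (2 - p)).
  by rewrite mulr_gt0// powR_gt0 ?invr_gt0// addr_gt0 ?expR_gt0.
move=> s s1; have s0 : 0 < s by lra.
have es0 : 0 < expR 1 + s by rewrite addr_gt0 ?expR_gt0.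
have -> : s ^+ 2 = s `^ p * s `^ (2 - p).
  by rewrite -powRD ?(gt_eqF s0) ?implybT// -powR_mulrn ?(ltW s0)//; congr (_ `^ _); lra.
rewrite /log_bump mulrCA ler_wpM2l ?powR_ge0//.
rewrite -mulrA -powRM ?(ltW s0)// ?addr_ge0 ?expR_ge0//.
apply: (@le_trans _ _ ((e^-1 * (expR 1 + s) `^ e) `^ a)).
  apply: ge0_ler_powR; rewrite ?nnegrE ?mulr_ge0 ?invr_ge0 ?powR_ge0 ?(ltW e0) ?(ltW a0)//.
    by have := ln_eD_ge1 (ltW s0); lra.
  rewrite mulrC ler_pdivlMr// mulrC -ln_powR.
  by apply/ltW/ln_sublinear; rewrite powR_gt0.
rewrite [leLHS]powRM ?invr_ge0 ?powR_ge0 ?(ltW e0)// -powRrM divfK ?gt_eqF//.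
rewrite ler_wpM2l ?powR_ge0//.
have := expR_gt0 (1 : R) => e1.
by apply: ge0_ler_powR; rewrite ?nnegrE; nra.
Qed.

(** Makes the integrand in [B2] nonnegative, so that its integral can be bounded below on a
    subinterval. *)
Lemma young_conj_log_bump_ge0 p delta t : 1 < p -> 0 < delta -> 1 <= t ->
  (0 <= young_conj (log_bump p delta) t)%E.
Proof.
move=> p1 d0 t1; set L := ln (expR 1 + 1 : R) `^ (p - 1 + delta).
have l1 := ln_eD_ge1 (@ler01 R).
have L1 : 1 <= L.
  apply: (@le_trans _ _ (1 `^ (p - 1 + delta))); first by rewrite powR1.
  by apply: ge0_ler_powR; rewrite ?nnegrE//; lra.
have L0 : 0 < L by lra.
(* This s solves s^p L = s. Since s <= 1, the log-bump at s is at most s^p L = s <= s t. *)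
pose s := L `^ (- (p - 1)^-1).
have s0 : 0 < s by rewrite powR_gt0.
have s1 : s <= 1.
  rewrite -[leRHS](powRr0 L); apply: ler_powR => //.
  by rewrite oppr_le0 invr_ge0; lra.
apply: (@le_trans _ _ (s * t - log_bump p delta s)%:E); last first.
  by apply: ereal_sup_ubound; exists s.
rewrite lee_fin subr_ge0; apply: (@le_trans _ _ s); last by rewrite ler_peMr// ltW.
apply: (@le_trans _ _ (s `^ p * L)).
  rewrite ler_wpM2l ?powR_ge0//; have := ln_eD_ge1 (ltW s0) => ls.
  apply: ge0_ler_powR; rewrite ?nnegrE//; try lra.
  by rewrite ler_ln ?posrE ?addr_gt0 ?expR_gt0// lerD2l.
have -> : s `^ p = s * L^-1.
  have -> : p = 1 + (p - 1) by lra.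
  rewrite powRD ?(gt_eqF s0) ?implybT// powRr1 ?(ltW s0)//; congr (_ * _).
  by rewrite /s -powRrM mulNr mulVf ?powR_inv1 ?(ltW L0)//; lra.
by rewrite mulfVK ?gt_eqF.
Qed.

Lemma integral_inv_itv (a X : R) : 0 < a -> a < X ->
  (\int[mu]_(t in `[a, X]) (t^-1)%:E = (ln X - ln a)%:E)%E.
Proof.
move=> a0 aX; rewrite (@continuous_FTC2 R (fun t => t^-1) (@ln R) a X aX).
- by rewrite EFinB.
- apply: continuous_in_subspaceT => t; rewrite inE/= in_itv/= => /andP[ta _].
  by apply: inv_continuous; rewrite gt_eqF//; lra.
- split.
  + move=> t; rewrite in_itv/= => /andP[ta _].
    by apply: ex_derive; apply: is_derive1_ln; lra.
  + by apply: cvg_at_right_filter; exact: continuous_ln.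
  + by apply: cvg_at_left_filter; apply: continuous_ln; lra.
- move=> t; rewrite in_itv/= => /andP[ta _].
  by rewrite derive1E; apply: derive_val; apply: is_derive1_ln; lra.
Qed.

(** If p < 2, the log-bump is at most quadratic, so its conjugate is at least quadratic, and the
    integrand in [B2] dominates a multiple of 1/t near infinity. *)
Lemma B2_log_bump_ge2 p delta : 1 < p -> 0 < delta ->
  B2 (young_conj (log_bump p delta)) -> 2 <= p.
Proof.
move=> p1 d0; rewrite leNgt => + ; apply: contraPN => p2.
have [M M0 hM] := log_bump_le_sqr p1 p2 d0.
(* s = c t maximises s t - M s^2, with value (c/2) t^2; [T] ensures c t >= 1, where the quadratic
   bound holds. *)
pose c := (2 * M)^-1; have c0 : 0 < c by rewrite invr_gt0 mulr_gt0.
pose T := Num.max 1 (c^-1).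
have T1 : 1 <= T by rewrite le_max lexx.
have Tc t : T <= t -> 1 <= c * t.
  by rewrite ge_max => /andP[_ h]; rewrite mulrC -ler_pdivrMr// div1r.
have conj_ge t : T <= t -> ((c / 2 * t ^+ 2)%:E <= young_conj (log_bump p delta) t)%E.
  move=> Tt; have ct := Tc _ Tt.
  apply: (@le_trans _ _ (c * t * t - log_bump p delta (c * t))%:E); last first.
    by apply: ereal_sup_ubound; exists (c * t) => //=; lra.
  rewrite lee_fin; have := hM _ ct.
  have -> : M * (c * t) ^+ 2 = c / 2 * t ^+ 2.
    by rewrite /c; field; rewrite gt_eqF.
  nra.
rewrite /B2; set I := (X in (X < _)%E).
suff -> : I = +oo%E by rewrite ltxx.
apply: eq_infty => r.
(* The integral of 1/t over [T, T e^n] is n, so this choice makes the lower bound at least r. *)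
pose n := Num.max 1 (r / (c / 2)).
pose X := T * expR n.
have n1 : 1 <= n by rewrite le_max lexx.
have T0 : 0 < T by lra.
have TX : T < X.
  by rewrite /X ltr_pMr// -expR0 ltr_expR; lra.
apply: (@le_trans _ _ ((c / 2)%:E * \int[mu]_(t in `[T, X]) (t^-1)%:E)%E).
  rewrite integral_inv_itv// /X lnM ?posrE ?expR_gt0// expRK addrAC subrr add0r.
  by rewrite -EFinM lee_fin mulrC -ler_pdivrMr ?divr_gt0// le_max lexx orbT.
rewrite -ge0_integralZl_EFin//; last 3 first.
- by move=> t; rewrite /= in_itv/= => /andP[Tt _]; rewrite lee_fin invr_ge0; lra.
- by apply/measurable_EFinP; apply: measurable_funTS; exact: measurable_inv.
- by rewrite divr_ge0// ltW.
rewrite /I (_ : `[T, X]%classic = `[1, +oo[%classic `&` `[T, X]%classic); last first.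
  apply/seteqP; split=> t /=; rewrite !in_itv/= ?andbT; last by case.
  by move=> /[dup] h /andP[Tt _]; split=> //; lra.
rewrite integral_mkcondr; apply: ge0_le_integral_nomeas => t /=; rewrite in_itv/= andbT => t1.
  rewrite patchE; case: ifP => // _.
  by rewrite -EFinM lee_fin mulr_ge0 ?invr_ge0 ?divr_ge0 ?(ltW c0)//; lra.
rewrite patchE; case: ifPn => [|_].
  rewrite inE/= in_itv/= => /andP[Tt _].
  have -> : ((c / 2)%:E * (t^-1)%:E = (c / 2 * t ^+ 2)%:E * ((t ^+ 3)^-1)%:E)%E.
    by rewrite -!EFinM; congr EFin; field; rewrite gt_eqF//; lra.
  apply: lee_wpmul2r; last exact: conj_ge.
  by rewrite lee_fin invr_ge0 exprn_ge0//; lra.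
by rewrite mule_ge0 ?young_conj_log_bump_ge0// lee_fin invr_ge0 exprn_ge0//; lra.
Qed.

(** Chebyshev argument: if lam < v/s, then A(|f|/lam) >= A(s) on E, and the mean over [a, c] exceeds
    1, so lam is not admissible. *)
Lemma lux_norm_ge (A f : R -> R) (a c v s : R) (E : set R) :
  a < c -> measurable E -> E `<=` `[a, c] ->
  (forall t, 0 <= A t) ->
  (forall t u, 0 <= t -> t <= u -> A t <= A u) ->
  0 < v -> 0 < s -> (forall y, E y -> v <= `|f y|) ->
  ((c - a)%:E < (A s)%:E * mu E)%E ->
  ((v / s)%:E <= lux_norm A a c f)%E.
Proof.
move=> ac mE Eac A0 And v0 s0 fv AE; apply: le_ereal_inf_tmp => _ [lam [lam0 +] <-].
rewrite lee_pdivrMl ?subr_gt0// mule1 => h.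
rewrite lee_fin leNgt; apply/negP => lamv.
move: AE; rewrite ltNge => /negP; apply.
apply: le_trans h; rewrite -integral_cst//.
rewrite (_ : E = `[a, c]%classic `&` E); last by rewrite setIidr.
rewrite integral_mkcondr; apply: ge0_le_integral_nomeas => y _.
  by rewrite patchE; case: ifP => // _; rewrite lee_fin.
rewrite patchE; case: ifPn => [|_]; last by rewrite lee_fin.
rewrite inE => Ey; rewrite lee_fin; apply: And; first exact: ltW.
rewrite ler_pdivlMr//; apply: le_trans (fv _ Ey).
by move: lamv; rewrite ltr_pdivlMr// mulrC => /ltW.
Qed.

End log_bump_theory.

(** * The spike function and oscillations on symmetric intervals *)

Section spikes.
Variable R : realType.
Local Notation mu := (@lebesgue_measure R).
Implicit Types (n : nat) (x y : R).

(* The height of the [n]-th spike is [2 + (n + 1) s_n], where [2] bounds the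
   averages of [spikes]; its width makes the [n]-th spike contribute [2^-(n+1)]
   to the squared L2 norm.  The size of [ln s_n] compensates the factor
   [2^-(n+1)], the ratio of height to [s_n], and the length [2 (n + 2)] of the
   interval of observation. *)
Definition spike_base n : R :=
  expR (2 ^ (n + 1) * (n + 3) ^ 2 * (2 * (n + 2)) + 1)%N%:R.

Definition spike_height n : R := 2 + n.+1%:R * spike_base n.

Definition spike_width n : R := 1 / (2 ^ (n + 1))%N%:R / spike_height n ^+ 2.

Definition spike_support n : set R := `[n.+1%:R, n.+1%:R + spike_width n]%classic.

(** Summing the squares of the spikes makes the squared L2 norm of [spikes] the exact sum of their
    contributions, with no discussion of overlaps. *)
Definition sqr_spikes x : \bar R :=
  (\sum_(n <oo) (spike_height n ^+ 2 * \1_(spike_support n) x)%:E)%E.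

Definition spikes x : R := fine (sqr_spikes x) `^ 2^-1.

Lemma spike_base_ge1 n : 1 <= spike_base n.
Proof. by rewrite -expR0 ler_expR. Qed.

Lemma spike_height_ge2 n : 2 <= spike_height n.
Proof.
by rewrite lerDl mulr_ge0//; have := spike_base_ge1 n; lra.
Qed.

Lemma pow2_gt0 n : 0 < (2 ^ (n + 1))%N%:R :> R.
Proof. by rewrite ltr0n expn_gt0. Qed.

Lemma spike_width_gt0 n : 0 < spike_width n.
Proof.
have h := spike_height_ge2 n.
by rewrite !divr_gt0 ?pow2_gt0 ?exprn_gt0//; lra.
Qed.

Lemma spike_width_le1 n : spike_width n <= 1.
Proof.
have h := spike_height_ge2 n.
rewrite /spike_width ler_pdivrMr ?exprn_gt0//; last lra.
apply: (@le_trans _ _ 1); last by rewrite mul1r; nra.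
by rewrite div1r invf_le1 ?pow2_gt0// ler1n expn_gt0.
Qed.

Lemma measurable_spike_support n : measurable (spike_support n).
Proof. exact: measurable_itv. Qed.

Lemma mu_spike_support n : mu (spike_support n) = (spike_width n)%:E.
Proof.
rewrite lebesgue_measure_itv/= lte_fin ltrDl spike_width_gt0.
by rewrite -EFinB addrAC subrr add0r.
Qed.

Let term_ge0 n x : (0 <= (spike_height n ^+ 2 * \1_(spike_support n) x)%:E)%E.
Proof. by rewrite lee_fin mulr_ge0 ?sqr_ge0// indicE. Qed.

Let measurable_term n :
  measurable_fun setT
    (fun x => (spike_height n ^+ 2 * \1_(spike_support n) x)%:E).
Proof.
apply/measurable_EFinP; apply: measurable_funM => //.
by apply: measurable_indic; exact: measurable_spike_support.
Qed.

Lemma measurable_sqr_spikes : measurable_fun setT sqr_spikes.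
Proof.
exact: (@ge0_emeasurable_sum _ _ R setT
  (fun n x => (spike_height n ^+ 2 * \1_(spike_support n) x)%:E) xpredT).
Qed.

Lemma measurable_spikes : measurable_fun setT spikes.
Proof.
apply: (measurableT_comp (@measurable_powR R 2^-1)).
exact: (measurableT_comp (@fine_measurable R setT _) measurable_sqr_spikes).
Qed.

Lemma sqr_spikes_ge0 x : (0 <= sqr_spikes x)%E.
Proof. by apply: nneseries_ge0 => n _ _; exact: term_ge0. Qed.

(** To the left of n+1 only the first n spikes can be nonzero. This yields finiteness, local
    boundedness and, for n = 0, the vanishing of [spikes] on x < 1. *)
Lemma sqr_spikes_le n x : x < n.+1%:R ->
  (sqr_spikes x <= (\sum_(0 <= k < n) spike_height k ^+ 2)%:E)%E.
Proof.
move=> xn; rewrite /sqr_spikes (nneseries_split 0 n)//.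
rewrite [X in (_ + X)%E]eseries0 ?adde0; last first.
  move=> k; rewrite add0n => nk _; rewrite indicE memNset ?mulr0//.
  rewrite /spike_support /= in_itv/= => /andP[+ _].
  have : n.+1%:R <= k.+1%:R :> R by rewrite ler_nat.
  lra.
rewrite add0n sumEFin lee_fin; apply: ler_sum => k _.
by rewrite ler_piMr ?sqr_ge0// indicE; case: (_ \in _).
Qed.

Lemma sqr_spikes_fin x : sqr_spikes x \is a fin_num.
Proof.
rewrite ge0_fin_numE ?sqr_spikes_ge0//.
exact: le_lt_trans (sqr_spikes_le (truncnS_gt x)) (ltry _).
Qed.

Lemma spikes_ge0 x : 0 <= spikes x.
Proof. exact: powR_ge0. Qed.

Lemma sqr_spikesE x : (spikes x ^+ 2)%:E = sqr_spikes x.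
Proof.
rewrite /spikes powR12_sqrt ?sqr_sqrtr ?fine_ge0 ?sqr_spikes_ge0//.
by rewrite fineK ?sqr_spikes_fin.
Qed.

Lemma spikes_eq0 x : x < 1 -> spikes x = 0.
Proof.
move=> x1; have := @sqr_spikes_le 0 x x1.
rewrite big_geq// -sqr_spikesE lee_fin => h.
by apply/eqP; rewrite -sqrf_eq0 eq_le h sqr_ge0.
Qed.

Lemma spikes_ge n x : spike_support n x -> spike_height n <= spikes x.
Proof.
move=> nx; have h := spike_height_ge2 n.
rewrite -(@ler_pXn2r _ 2)// ?nnegrE ?spikes_ge0//; last lra.
rewrite -lee_fin sqr_spikesE.
apply: le_trans (nneseries_lim_ge n.+1 (fun k _ _ => term_ge0 k x)).
rewrite big_nat_recr//= indicE mem_set// mulr1 leeDr// sume_ge0//.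
Qed.

Lemma Linf_loc_spikes : Linf_loc spikes.
Proof.
split; first exact: measurable_spikes.
move=> a c; pose n := Num.truncn c.
exists ((\sum_(0 <= k < n) spike_height k ^+ 2) `^ 2^-1).
apply: aeW => x; rewrite in_itv/= => /andP[_ xc].
rewrite ger0_norm ?spikes_ge0//; apply: ge0_ler_powR.
- by rewrite invr_ge0.
- by rewrite nnegrE fine_ge0// sqr_spikes_ge0.
- by rewrite nnegrE sumr_ge0// => k _; rewrite sqr_ge0.
rewrite -lee_fin fineK ?sqr_spikes_fin//; apply: sqr_spikes_le.
exact: le_lt_trans xc (truncnS_gt c).
Qed.

Lemma integral_sqr_spikes : (\int[mu]_x (spikes x ^+ 2)%:E = 1)%E.
Proof.
under eq_integral do rewrite sqr_spikesE.
rewrite integral_nneseries//.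
transitivity (\sum_(n <oo) (1 / (2 ^ (n + 1))%N%:R : R)%:E)%E; last first.
  have := @cvg_geometric_eseries_half R 1 0; rewrite expr0 divr1.
  by move/cvg_lim => <-.
apply: eq_eseriesr => n _.
under eq_integral do rewrite EFinM.
rewrite ge0_integralZl_EFin ?sqr_ge0//; last first.
  apply/measurable_EFinP; apply: measurable_indic.
  exact: measurable_spike_support.
rewrite integral_indic//; last exact: measurable_spike_support.
rewrite setIT [X in (_ * X)%E]mu_spike_support -EFinM; congr EFin.
by rewrite /spike_width mulrC divfK// expf_eq0/= gt_eqF//; have := spike_height_ge2 n; lra.
Qed.

(** From b <= 1 + b^2 and unit squared norm, the integral is at most (c-a) + 1 <= 2(c-a). *)
Lemma avg_spikes_le a c : 1 <= c - a -> avg a c spikes <= 2.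
Proof.
move=> ac; have ca0 : 0 < c - a by lra.
rewrite /avg mulrC ler_pdivrMr//.
rewrite /Rintegral; set I := (X in fine X).
suff : (I <= (c - a + 1)%:E)%E.
  move=> h; have : I \is a fin_num.
    rewrite ge0_fin_numE; first exact: le_lt_trans h (ltry _).
    by apply: integral_ge0 => x _; rewrite lee_fin spikes_ge0.
  by move=> If; move: h; rewrite -(fineK If) lee_fin; lra.
have mI : measurable `[a, c]%classic by exact: measurable_itv.
apply: (@le_trans _ _ (\int[mu]_(x in `[a, c]) (1 + (spikes x ^+ 2)%:E))%E).
  apply: ge0_le_integral_nomeas => x _; rewrite -?EFinD lee_fin ?spikes_ge0//.
  by have := spikes_ge0 x; nra.
rewrite ge0_integralD//; last 2 first.
- by move=> x _; rewrite lee_fin sqr_ge0.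
- apply/measurable_EFinP; apply: measurable_funX; apply: measurable_funTS.
  exact: measurable_spikes.
rewrite EFinD; apply: leeD.
  rewrite integral_cst// mul1e [X in (X <= _)%E]lebesgue_measure_itv/= lte_fin.
  by case: ifP => // _; rewrite ?lee_fin ?EFinB//; lra.
rewrite -integral_sqr_spikes; apply: ge0_subset_integral => //.
  by apply/measurable_EFinP; apply: measurable_funX; exact: measurable_spikes.
by move=> x _; rewrite lee_fin sqr_ge0.
Qed.

Lemma log_bump_spike_gt n p delta : 2 <= p -> 0 < delta ->
  2 * n.+2%:R < log_bump p delta (spike_base n) * spike_width n.
Proof.
move=> p2 d0; have s1 := spike_base_ge1 n; have h2 := spike_height_ge2 n.
have w0 := spike_width_gt0 n; have q0 := pow2_gt0 n.
apply: (@lt_le_trans _ _ (spike_base n ^+ 2 * ln (spike_base n) * spike_width n));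
  last by rewrite ler_wpM2r ?(ltW w0) ?log_bump_ge_sqr_ln.
rewrite {2}/spike_base expRK /spike_width.
set q := (2 ^ (n + 1))%N%:R in q0 *.
(* Since s_n >= 1, 2 + (n+1) s_n <= (n+3) s_n; this is the source of (n+3)^2 in [spike_base]. *)
have hs : spike_height n <= (n + 3)%N%:R * spike_base n.
  by rewrite /spike_height -addn1 !natrD; nra.
rewrite natrD !natrM !natrX -/q.
set s := spike_base n in s1 hs *; set h := spike_height n in h2 hs *.
rewrite [ltRHS](_ : _ = s ^+ 2 * ((2 ^+ (n + 1) * (n + 3)%:R ^+ 2 * (2 * (n + 2)%:R) + 1) / q) / h ^+ 2); last first.
  by field; rewrite !gt_eqF//; lra.
rewrite ltr_pdivlMr ?exprn_gt0//; last lra.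
have -> : 2 ^+ (n + 1) = q by rewrite /q natrX.
set m := (n + 3)%:R in hs *.
have h2s : h ^+ 2 <= m ^+ 2 * s ^+ 2.
  by rewrite -exprMn ler_pXn2r// ?nnegrE ?mulr_ge0 ?ler0n//; lra.
have n2 : n.+2%:R = (n + 2)%:R :> R by rewrite addn2.
rewrite n2; set k := (n + 2)%:R.
have k0 : 0 < k by rewrite ltr0n addn2.
apply: (@le_lt_trans _ _ (2 * k * (m ^+ 2 * s ^+ 2))); first by rewrite ler_wpM2l// mulr_ge0// ltW.
(* The surplus s^2/q comes from the summand 1 in the exponent of [spike_base] and makes the
   inequality strict. *)
have -> : s ^+ 2 * ((q * m ^+ 2 * (2 * k) + 1) / q) = 2 * k * (m ^+ 2 * s ^+ 2) + s ^+ 2 / q.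
  by field; rewrite gt_eqF.
by rewrite ltrDl divr_gt0// exprn_gt0//; lra.
Qed.

(** On the n-th spike the oscillation is at least (n+1) s_n, the average being at most 2;
    [lux_norm_ge] then divides by s_n. The factor [kappa] serves both suprema: 1 for [S_AB], 1/2 for
    [T_C]. *)
Lemma lux_norm_spikes_ge n p delta (kappa : R) (f : R -> R) :
  2 <= p -> 0 < delta -> 0 < kappa ->
  (forall y, kappa * osc spikes (- n.+2%:R) n.+2%:R y <= `|f y|) ->
  ((kappa * n.+1%:R)%:E
     <= lux_norm (log_bump p delta) (- n.+2%:R) n.+2%:R f)%E.
Proof.
move=> p2 d0 k0 kf; have s1 := spike_base_ge1 n; set s := spike_base n in s1.
have n0 : 1 <= n.+1%:R :> R by rewrite ler1n.
have n2E : n.+2%:R = n.+1%:R + 1 :> R by rewrite -addn1 natrD.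
have -> : kappa * n.+1%:R = kappa * n.+1%:R * s / s by rewrite mulfK// gt_eqF//; lra.
apply: (@lux_norm_ge _ _ _ _ _ _ _ (spike_support n)).
- lra.
- exact: measurable_spike_support.
- move=> x; rewrite /spike_support /= !in_itv/= => /andP[x1 x2].
  by have w1 := spike_width_le1 n; apply/andP; split; lra.
- exact: log_bump_ge0.
- by move=> t u; apply: log_bump_nd; lra.
- by rewrite !mulr_gt0//; lra.
- lra.
- move=> y /spikes_ge hy; apply: le_trans (kf y); rewrite -mulrA ler_pM2l//.
  rewrite /osc; apply: le_trans (ler_norm _).
  have /avg_spikes_le : 1 <= n.+2%:R - - n.+2%:R :> R by lra.
  by move: hy; rewrite /spike_height -/s; lra.
rewrite mu_spike_support -EFinM lte_fin opprK.
by have := @log_bump_spike_gt n p delta p2 d0; rewrite -/s; lra.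
Qed.

Lemma osc_half_line (L : R) y : 0 < L -> osc (@half_line R) (- L) L y = 2^-1.
Proof.
move=> L0; rewrite /osc (_ : avg _ _ _ = 2^-1).
  by rewrite half_lineE; case: ltP => _ /=; rewrite ?sub0r ?normrN ger0_norm; lra.
rewrite /avg /Rintegral /half_line integral_indic//.
rewrite (_ : _ `&` _ = `[- L, 0[%classic); last first.
  apply/seteqP; split=> x /=; rewrite !in_itv/=.
    by move=> [-> /andP[-> _]].
  by move=> /andP[-> x0]; rewrite x0; split=> //=; lra.
rewrite [X in fine X]lebesgue_measure_itv/= lte_fin oppr_lt0 L0 -EFinB/=.
by field; rewrite !gt_eqF//; lra.
Qed.

Lemma lux_norm_osc_half_line_ge p delta (L : R) : 1 < p -> 0 < delta -> 0 < L ->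
  ((4^-1)%:E <= lux_norm (log_bump p delta) (- L) L (osc (@half_line R) (- L) L))%E.
Proof.
(* [lux_norm_ge] with v = 1/2, s = 2 and the whole interval as E: the log-bump at 2 is at least 2^p
   > 1. *)
move=> p1 d0 L0; have -> : 4^-1 = 2^-1 / 2 :> R by lra.
apply: (@lux_norm_ge _ _ _ _ _ _ _ `[- L, L]%classic).
- lra.
- exact: measurable_itv.
- by [].
- exact: log_bump_ge0.
- by move=> t u; exact: log_bump_nd.
- by [].
- by [].
- by move=> y _; rewrite osc_half_line// ger0_norm.
rewrite [X in (_ * X)%E]lebesgue_measure_itv/= lte_fin ifT; last lra.
rewrite -EFinB -EFinM lte_fin ltr_pMl; last lra.
apply: lt_le_trans (log_bump_ge_powR p1 d0 _) => //.
by apply: (@lt_le_trans _ _ (2 `^ 1)); [rewrite powRr1; lra|apply: ler_powR; lra].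
Qed.

Lemma Linf_loc_half_line : Linf_loc (@half_line R).
Proof.
split; first exact: measurable_half_line.
move=> a c; exists 1; apply: aeW => x _.
by rewrite half_lineE; case: (x < 0); rewrite ?normr1 ?normr0.
Qed.

End spikes.

Theorem theorem4p7 (R : realType) :
  exists b1 b2 : R -> R,
    [/\ Linf_loc b1, Linf_loc b2,
        L2_bounded (CbH b1 b2),
        (forall A B : R -> R, is_log_bump A -> is_log_bump B ->
            B2 (young_conj A) -> B2 (young_conj B) ->
            S_AB A B b1 b2 = +oo%E)
      & (forall C : R -> R, is_log_bump C -> B2 (young_conj C) ->
            T_C C b1 b2 = +oo%E)].
Proof.
(* The factor 4 offsets the lower bound 1/4 for the norm of the oscillation of [half_line]. *)
have unbounded (r : R) : exists n, 4 * r <= n.+1%:R.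
  by exists (Num.truncn (4 * r)); exact/ltW/truncnS_gt.
have n2 n : 0 < n.+2%:R :> R by rewrite ltr0n.
have n2lt n : - n.+2%:R < n.+2%:R :> R by have := n2 n; lra.
exists (@spikes R), (@half_line R); split.
- exact: Linf_loc_spikes.
- exact: Linf_loc_half_line.
- apply: half_line_commutator_bounded; first exact: measurable_spikes.
  + exact: spikes_ge0.
  + exact: spikes_eq0.
  + by apply: L2norm_fin; rewrite integral_sqr_spikes ltry.
- move=> A B [p [delta [p1 [d0 ->]]]] [q [eta [q1 [e0 ->]]]] hA _.
  have p2 := B2_log_bump_ge2 p1 d0 hA.
  apply: eq_infty => r; have [n rn] := unbounded r.
  apply: (@le_trans _ _ (n.+1%:R%:E * (4^-1)%:E)%E).
    by rewrite -EFinM lee_fin; lra.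
  apply: le_trans; last by apply: ereal_sup_ubound; exists (- n.+2%:R, n.+2%:R); [exact: n2lt|].
  rewrite /=; apply: lee_pmul.
  + by rewrite lee_fin.
  + by rewrite lee_fin; lra.
  + have := @lux_norm_spikes_ge R n p delta 1 _ p2 d0 ltr01; rewrite mul1r; apply.
    by move=> y; rewrite mul1r normr_id.
  + exact: lux_norm_osc_half_line_ge.
- move=> C [p [delta [p1 [d0 ->]]]] hC.
  have p2 := B2_log_bump_ge2 p1 d0 hC.
  apply: eq_infty => r; have [n rn] := unbounded r.
  apply: (@le_trans _ _ (2^-1 * n.+1%:R)%:E).
    have : 0 <= n.+1%:R :> R by [].
    by rewrite lee_fin; lra.
  apply: le_trans; last by apply: ereal_sup_ubound; exists (- n.+2%:R, n.+2%:R); [exact: n2lt|].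
  (* [kappa] is 1/2, the constant oscillation of [half_line]. *)
  rewrite /=; apply: lux_norm_spikes_ge => // y.
  by rewrite osc_half_line// mulrC ler_norm.
Qed.
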